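(* Let $\theta \in [0,1]$ and $0 < p \leq q$. Then the $\theta$-intermediate dimension $\dim_\theta S_{p,q}$ of the elliptical polynomial spiral $S_{p,q}$ exists (i.e. the lower and upper $\theta$-intermediate dimensions coincide), and: if $p < 1$, then $$\dim_\theta S_{p,q} = \frac{p+q+2\theta(1-p)}{p+q+\theta(1-p)};$$ otherwise, if $p \geq 1$, then $\dim_\theta S_{p,q} = 1$.
   Context: For $0<p\le q$, the elliptical polynomial spiral is $S_{p,q} = \{ t^{-p}\cos t + i\, t^{-q}\sin t : 1 < t < \infty\} \subset \mathbb{C} \cong \mathbb{R}^2$. Intermediate dimensions: write $|U|$ for the diameter of a set $U$. For bounded $E \subset \mathbb{R}^n$ and $0<\theta\le 1$, the lower $\theta$-intermediate dimension $\underline{\dim}_\theta E$ is the infimum of $s \ge 0$ such that for all $\epsilon>0$ and all $\delta_0>0$ there exist $0<\delta\le\delta_0$ and a cover $\{U_i\}$ of $E$ with $\delta \le |U_i| \le \delta^\theta$ for all $i$ and $\sum_i |U_i|^s \le \epsilon$. The upper $\theta$-intermediate dimension $\overline{\dim}_\theta E$ is the infimum of $s\ge 0$ such that for all $\epsilon>0$ there exists $\delta_0>0$ such that for all $0<\delta\le\delta_0$ there is a cover $\{U_i\}$ of $E$ with $\delta \le |U_i| \le \delta^\theta$ for all $i$ and $\sum_i |U_i|^s \le \epsilon$. For $\theta=0$, $\underline{\dim}_0 E = \overline{\dim}_0 E = \dim_{\mathrm{H}} E$ (Hausdorff dimension). If $\underline{\dim}_\theta E = \overline{\dim}_\theta E$,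 the common value is denoted $\dim_\theta E$. *)

(* Defs.v *)
From mathcomp Require Import all_boot all_order all_algebra.
From mathcomp Require Import all_classical all_reals all_analysis.
Set Implicit Arguments.
Unset Strict Implicit.
Unset Printing Implicit Defensive.
Import Order.TTheory GRing.Theory Num.Theory.

Local Open Scope classical_set_scope.
Local Open Scope ring_scope.

(* The Euclidean distance: the library norm on 'rV[R]_n is the sup norm. *)
Definition edist (R : realType) (n : nat) (x y : 'rV[R]_n) : R :=
  Num.sqrt (\sum_(j < n) (x ord0 j - y ord0 j) ^+ 2).

(* The element 0 is added so that the empty set has diameter 0, not -oo. *)
Definition diam (R : realType) (n : nat) (U : set 'rV[R]_n) : \bar R :=
  ereal_sup (0%E |` [set (edist xy.1 xy.2)%:E | xy in U `*` U]).

(* The family (U i), i in I, is a cover of E. Every finite or countable family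
   of sets can be indexed by a subset I of nat. *)
Definition is_cover (R : realType) (n : nat) (E : set 'rV[R]_n)
    (I : set nat) (U : nat -> set 'rV[R]_n) : Prop :=
  E `<=` \bigcup_(i in I) U i.

Definition diam_sum (R : realType) (n : nat) (s : R)
    (I : set nat) (U : nat -> set 'rV[R]_n) : \bar R :=
  \esum_(i in I) (diam (U i) `^ s)%E.

Definition hausdorff_premeasure (R : realType) (n : nat) (s delta : R)
    (E : set 'rV[R]_n) : \bar R :=
  ereal_inf [set v | exists (I : set nat) (U : nat -> set 'rV[R]_n),
    [/\ is_cover E I U,
        forall i, I i -> (diam (U i) <= delta%:E)%E
      & v = diam_sum s I U]].

(* The premeasures increase as delta decreases to 0, so their limit is a
   supremum. *)
Definition hausdorff_measure (R : realType) (n : nat) (s : R)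
    (E : set 'rV[R]_n) : \bar R :=
  ereal_sup [set hausdorff_premeasure s delta E | delta in [set d : R | 0 < d]].

Definition hausdorff_dim (R : realType) (n : nat) (E : set 'rV[R]_n) : \bar R :=
  ereal_inf [set s%:E | s in [set s : R | 0 <= s /\ hausdorff_measure s E = 0%E]].

Definition has_theta_cover (R : realType) (n : nat) (theta s eps delta : R)
    (E : set 'rV[R]_n) : Prop :=
  exists (I : set nat) (U : nat -> set 'rV[R]_n),
    [/\ is_cover E I U,
        forall i, I i -> (delta%:E <= diam (U i) <= (delta `^ theta)%:E)%E
      & (diam_sum s I U <= eps%:E)%E].

(* The lower and upper intermediate dimensions are meant for bounded E and
   theta in [0, 1]. *)
Definition lower_intermediate_dim (R : realType) (n : nat) (theta : R)
    (E : set 'rV[R]_n) : \bar R :=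
  if theta == 0 then hausdorff_dim E else
  ereal_inf [set s%:E | s in [set s : R | 0 <= s /\
    forall eps delta0 : R, 0 < eps -> 0 < delta0 ->
      exists delta : R,
        0 < delta <= delta0 /\ has_theta_cover theta s eps delta E]].

Definition upper_intermediate_dim (R : realType) (n : nat) (theta : R)
    (E : set 'rV[R]_n) : \bar R :=
  if theta == 0 then hausdorff_dim E else
  ereal_inf [set s%:E | s in [set s : R | 0 <= s /\
    forall eps : R, 0 < eps ->
      exists2 delta0 : R, 0 < delta0 &
        forall delta : R, 0 < delta <= delta0 ->
          has_theta_cover theta s eps delta E]].

(* C is identified with R^2: x + i y is the row vector (x, y). *)
Definition elliptical_spiral (R : realType) (p q : R) : set 'rV[R]_2 :=
  [set \row_(j < 2) (if j == ord0 then t `^ (- p) * cos t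
                     else t `^ (- q) * sin t) | t in [set t : R | 1 < t]].

(* Main.v *)
(* Let a = theta / (p + q + theta (1 - p)) and sigma = 1 + a (1 - p), which for p < 1 is the
   claimed value; a is chosen so that a (p + q) = theta (2 - sigma).

   Upper bound: split the spiral at t = delta^-a. In the variable u = t^(1 - p)
   the curve is Lipschitz, so the outer part is covered by about
   delta^(-a (1 - p) - 1) squares of diameter delta. The inner part lies in a
   rectangle of area about delta^(a (p + q)), which is cut into squares of
   diameter delta^theta. If p >= 1, the same argument is run with p replaced by
   a number p' < 1 close to 1 in the Lipschitz estimate.

   Lower bound: take m, of order delta^-a, consecutive turns at t of order m,
   and on each turn a short arc near the point where the curve is horizontal.
   These arcs project onto intervals of length of order m^-p, and a set of
   diameter d meets at most 1 + C d m^(q + 1) of them. Adding up over the arcs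
   the covering inequality for the projections gives
   c m^(1 - p) <= sum d (1 + C d m^(q + 1)), and each term is at most
   C' m^(1 - p) d^sigma when delta <= d <= delta^theta. For exponents below 1, one
   arc is enough. *)
Require Import Defs.
From mathcomp Require Import all_boot all_order all_algebra.
From mathcomp Require Import all_classical all_reals all_analysis.
From mathcomp Require Import ring lra.
Set Implicit Arguments.
Unset Strict Implicit.
Unset Printing Implicit Defensive.
Import Order.TTheory GRing.Theory Num.Theory.
Import numFieldNormedType.Exports.
Local Open Scope classical_set_scope.
Local Open Scope ring_scope.

(** * Real powers *)

Lemma powR_ge1 (R : realType) (x r : R) : 1 <= x -> 0 <= r -> 1 <= x `^ r.
Proof. by move=> x1 r0; rewrite -(powRr0 x) ler_powR. Qed.

Lemma powRN_le (R : realType) (r x y : R) : 0 <= r -> 0 < x -> x <= y ->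
  y `^ (- r) <= x `^ (- r).
Proof.
move=> r0 x0 xy; have y0 : 0 < y by exact: lt_le_trans xy.
rewrite !powRN lef_pV2 ?posrE ?powR_gt0//.
by apply: ge0_ler_powR => //; rewrite nnegrE ltW.
Qed.

Lemma is_derive_powRN (R : realType) (r x : R) : 0 < x ->
  is_derive x 1 (fun t : R => t `^ (- r)) (- r * x `^ (- r - 1)).
Proof. by move=> x0; exact: is_derive1_powR. Qed.

(** Mean value theorem for [t ^ (- r)]: the modulus of the derivative is decreasing, hence on
    [[T, 2 * T]] it lies between its values at the two ends. *)
Lemma powRN_sub_bounds (R : realType) (r T x y : R) : 0 <= r -> 0 < T ->
  T <= x -> x <= y -> y <= 2 * T ->
  r * (2 * T) `^ (- r - 1) * (y - x) <= x `^ (- r) - y `^ (- r) /\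
  x `^ (- r) - y `^ (- r) <= r * T `^ (- r - 1) * (y - x).
Proof.
move=> r0 T0 Tx xy yT.
have x0 : 0 < x by exact: lt_le_trans Tx.
have D z : z \in `[x, y] -> is_derive z 1 (fun t : R => t `^ (- r)) (- r * z `^ (- r - 1)).
  rewrite in_itv/= => /andP[xz _]; apply: is_derive_powRN; exact: lt_le_trans xz.
have cont : {within `[x, y], continuous (fun t : R => t `^ (- r))}.
  apply: derivable_within_continuous => z zxy.
  by have := D z zxy => -[].
have [z zxy E] := @MVT_segment R (fun t : R => t `^ (- r)) (fun c => - r * c `^ (- r - 1))
  x y xy (fun z zxy => D z (subset_itv_oo_cc zxy)) cont.
move: zxy; rewrite in_itv/= => /andP[xz zy].
have -> : x `^ (- r) - y `^ (- r) = r * z `^ (- r - 1) * (y - x) by lra.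
have r1 : 0 <= r + 1 by lra.
have yx : 0 <= y - x by lra.
have -> : - r - 1 = - (r + 1) by ring.
split; apply: ler_wpM2r => //; apply: ler_wpM2l => //; apply: powRN_le; lra.
Qed.

Lemma powRD_gt0 (R : realType) (x r s : R) : 0 < x ->
  x `^ (r + s) = x `^ r * x `^ s.
Proof. by move=> x0; rewrite powRD// lt0r_neq0// implybT. Qed.

Lemma powR2N_le_half (R : realType) (r : R) : 1 <= r -> (2 : R) `^ (- r) <= 1/2.
Proof.
move=> r1; rewrite [leRHS](_ : _ = (2 : R) `^ (- 1)).
  by apply: ler_powR; lra.
by rewrite powR_inv1// div1r.
Qed.

Lemma powR_le_root (R : realType) (r x y : R) : 0 < r -> 0 <= x -> 0 <= y ->
  x <= y `^ r^-1 -> x `^ r <= y.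
Proof.
move=> r0 x0 y0 xy; rewrite -[leRHS](powRr1 y0) -(mulVf (lt0r_neq0 r0)) powRrM.
by apply: ge0_ler_powR; rewrite ?nnegrE ?powR_ge0// ltW.
Qed.

(** * Diameters, and covering sums of projections *)

Lemma coord_le_edist (R : realType) (n : nat) (x y : 'rV[R]_n) (j : 'I_n) :
  `|x ord0 j - y ord0 j| <= Defs.edist x y.
Proof.
rewrite /Defs.edist -sqrtr_sqr; apply: ler_wsqrtr.
rewrite (bigD1 j)//= lerDl; apply: sumr_ge0 => i _; exact: sqr_ge0.
Qed.

Lemma edist_le_diam (R : realType) (n : nat) (U : set 'rV[R]_n) (x y : 'rV[R]_n) :
  U x -> U y -> ((Defs.edist x y)%:E <= diam U)%E.
Proof. by move=> Ux Uy; apply: ereal_sup_ubound; right; exists (x, y). Qed.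

Lemma diam_ge0 (R : realType) (n : nat) (U : set 'rV[R]_n) : (0 <= diam U)%E.
Proof. by apply: ereal_sup_ubound; left. Qed.

Lemma coord_le_diam (R : realType) (n : nat) (U : set 'rV[R]_n) (x y : 'rV[R]_n)
    (j : 'I_n) : diam U \is a fin_num -> U x -> U y ->
  `|x ord0 j - y ord0 j| <= fine (diam U).
Proof.
move=> fU Ux Uy; apply: le_trans (coord_le_edist x y j) _.
by rewrite -lee_fin fineK//; exact: edist_le_diam.
Qed.

(** With [k0] the least index satisfying [h], all the others lie in a window of [Num.truncn X + 1]
    integers starting at [k0]. *)
Lemma count_le_spread (R : realType) (m : nat) (h : pred nat) (X : R) :
  0 <= X ->
  (forall k l, (k <= l < m)%N -> h k -> h l -> (l - k)%:R <= X) ->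
  (count h (iota 0 m))%:R <= 1 + X.
Proof.
move=> X0 H; rewrite -size_filter.
case: (pselect (exists k, (k < m)%N && h k)) => [ex|nex]; last first.
  suff -> : [seq x <- iota 0 m | h x] = [::] by rewrite /= addr_ge0.
  apply/eqP; rewrite -[_ == _]negbK -has_filter; apply/negP => /hasP[k].
  by rewrite mem_iota add0n/= => km hk; apply: nex; exists k; rewrite km.
have [k0 /andP[k0m hk0] kmin] := ex_minnP ex.
have XD : X \is Num.nneg by rewrite nnegrE.
pose N := Num.truncn X.
have sub : {subset [seq x <- iota 0 m | h x] <= iota k0 N.+1}.
  move=> l; rewrite mem_filter !mem_iota add0n/= => /andP[hl lm].
  have k0l : (k0 <= l)%N by apply: kmin; rewrite lm.
  rewrite k0l/= addnS ltnS -leq_subLR /N truncn_ge_nat//.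
  by apply: H => //; rewrite k0l.
have := uniq_leq_size (filter_uniq h (iota_uniq 0 m)) sub.
rewrite size_iota => le; apply: (@le_trans _ _ (N.+1)%:R); first by rewrite ler_nat.
by rewrite -addn1 natrD addrC lerD2l /N truncn_le.
Qed.

(** Countable subadditivity of Lebesgue measure. The sets [V i] need not be measurable, so each is
    replaced by a closed interval of radius [d i] about one of its points, which costs the factor
    2. *)
Lemma interval_cover_sum (R : realType) (a b : R) (I : set nat)
    (V : nat -> set R) (d : nat -> R) :
  a <= b ->
  `[a, b] `<=` \bigcup_(i in I) V i ->
  (forall i, I i -> 0 <= d i) ->
  (forall i x y, I i -> V i x -> V i y -> `|x - y| <= d i) ->
  ((b - a)%:E <= \esum_(i in I) (2 * d i)%:E)%E.
Proof.
move=> ab cov d0 Vd.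
(* The default 0 is harmless: the centre of [B i] matters only when [V i] contains some point
   [x]. *)
pose c i := xget 0 (V i).
pose B i := if i \in I then `[c i - d i, c i + d i]%classic else set0.
have mB i : measurable (B i) by rewrite /B; case: ifP.
have sub : `[a, b]%classic `<=` \bigcup_i B i.
  move=> x /cov [i Ii Vix]; exists i => //; rewrite /B ifT ?inE//= in_itv/=.
  have Vc : V i (c i) by rewrite /c; case: xgetP => [y _|/(_ x)].
  by have := Vd _ _ _ Ii Vix Vc; rewrite ler_norml; lra.
have mab : measurable `[a, b]%classic by exact: measurable_itv.
have : (lebesgue_measure (`[a, b]%classic : set R) <= \sum_(n <oo) lebesgue_measure (B n))%E.
  exact: measure_sigma_subadditive.
rewrite lebesgue_measure_itv/= lte_fin.
have [ab'|] := ltP a b; last first.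
  move=> ba _; have -> : b - a = 0 by lra.
  by apply: esum_ge0 => i Ii; rewrite lee_fin; have := d0 _ Ii; lra.
rewrite -EFinB => /le_trans; apply.
rewrite nneseries_esumT; last by move=> n; exact: measure_ge0.
rewrite [leRHS]esum_mkcond; apply: le_esum => i _.
rewrite /B; case: ifPn => [|_]; last by rewrite measure0.
rewrite inE => /d0 di; rewrite lebesgue_measure_itv/= lte_fin.
case: ifPn => _; rewrite lee_fin; lra.
Qed.

(** Each arc gives a covering inequality for its projection. Summed over the arcs and with the two
    sums exchanged, [U i] is counted once for each arc that it meets, that is at most [1 + X i]
    times. *)
Lemma arcs_cover_sum (R : realType) (E : set 'rV[R]_2) (m : nat)
    (A : nat -> set 'rV[R]_2) (l : R) (I : set nat) (U : nat -> set 'rV[R]_2)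
    (X : nat -> R) :
  0 <= l ->
  is_cover E I U ->
  (forall k, (k < m)%N -> A k `<=` E) ->
  (forall k, (k < m)%N -> `[- l, 0] `<=` (fun z : 'rV[R]_2 => z ord0 ord0) @` A k) ->
  (forall i, I i -> diam (U i) \is a fin_num) ->
  (forall i, I i -> 0 <= X i) ->
  (forall i k j, I i -> (k <= j < m)%N ->
     U i `&` A k !=set0 -> U i `&` A j !=set0 -> (j - k)%:R <= X i) ->
  ((m%:R * l)%:E <= \esum_(i in I) (2 * fine (diam (U i)) * (1 + X i))%:E)%E.
Proof.
move=> l0 cov AE Al fU X0 UX.
pose h i k := `[< U i `&` A k !=set0 >].
(* [U i] is charged to the [k]-th arc only if it meets this arc. *)
pose d i k := (h i k)%:R * fine (diam (U i)).
have df i : 0 <= fine (diam (U i)) by rewrite fine_ge0// diam_ge0.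
have d0 i k : 0 <= d i k by rewrite mulr_ge0.
have one k : (k < m)%N -> (l%:E <= \esum_(i in I) (2 * d i k)%:E)%E.
  move=> km; have -> : l = 0 - (- l) by ring.
  apply: (@interval_cover_sum _ _ _ _
    (fun i => (fun z : 'rV[R]_2 => z ord0 ord0) @` (U i `&` A k))) => //.
  - by rewrite oppr_le0.
  - move=> x /(Al _ km) [z Az <-]; have [i Ii Uz] := cov _ (AE _ km _ Az).
    by exists i => //; exists z.
  - move=> i _ _ Ii [z [Uz Az] <-] [z' [Uz' _] <-].
    rewrite /d (_ : h i k = true); last by apply/asboolP; exists z.
    by rewrite mul1r; apply: coord_le_diam => //; exact: fU.
apply: (@le_trans _ _ (\sum_(k <- iota 0 m) \esum_(i in I) (2 * d i k)%:E)%E).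
  have -> : (m%:R * l)%:E = (\sum_(k <- iota 0 m) l%:E)%E :> \bar R.
    rewrite sumEFin big_const_seq count_predT size_iota iter_addr_0.
    by rewrite mulr_natl.
  rewrite big_seq [leRHS]big_seq; apply: lee_sum => k; rewrite mem_iota => /andP[_].
  exact: one.
rewrite -esum_sum; last by move=> i k _ _; rewrite lee_fin mulr_ge0.
apply: le_esum => i Ii; rewrite sumEFin lee_fin -mulr_sumr -mulrA ler_wpM2l//.
rewrite /d -mulr_suml mulrC ler_wpM2l//.
have -> : (\sum_(k <- iota 0 m) (h i k)%:R : R) = (count (h i) (iota 0 m))%:R.
  by rewrite -natr_sum -sum1_count [in RHS]big_mkcond.
apply: count_le_spread; first exact: X0.
by move=> k j kj /asboolP hk /asboolP hj; exact: UX kj hk hj.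
Qed.

(** * Separation of consecutive turns *)

Lemma sin_le_id (R : realType) (x : R) : 0 <= x -> sin x <= x.
Proof.
move=> x0.
have cont : {within `[0, x], continuous (@sin R)}.
  by apply: continuous_subspaceT => z; exact: continuous_sin.
have [c _] := @MVT_segment R sin cos 0 x x0 (fun z _ => is_derive_sin z) cont.
rewrite sin0 !subr0 => ->; have := cos_le1 c; nra.
Qed.

(* Consecutive turns are about [T ^ (- q - 1)] apart vertically. Since the arcs
   are close to horizontal ([a, a' <= eps], with [a = - cos t] and [b = sin t]),
   a horizontal displacement cannot compensate this gap; [eps] is small enough
   for the error terms to be absorbed by the gap. *)
Lemma arc_gap (R : realType) (p q T t t' a b a' b' : R) :
  let eps := (2 : R) `^ (- (q + 4)) in
  0 < p -> p <= q -> 1 <= T -> T <= t -> t <= t' -> t' <= 2 * T ->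
  0 <= a <= eps -> 0 <= a' <= eps -> 1/2 <= b -> 1/2 <= b' ->
  a ^+ 2 + b ^+ 2 = 1 -> a' ^+ 2 + b' ^+ 2 = 1 ->
  q * eps * T `^ (- q - 1) * (t' - t) <=
    `|- (t `^ (- p) * a) - - (t' `^ (- p) * a')| +
    `|t `^ (- q) * b - t' `^ (- q) * b'|.
Proof.
move=> eps p0 pq T1 Tt tt tT /andP[a0 ae] /andP[a0' ae'] bh bh' ab ab'.
have T0 : 0 < T by lra.
have q0 : 0 < q by lra.
have eps0 : 0 < eps by apply: powR_gt0.
have eps_le : eps <= 1/2 by apply: powR2N_le_half; lra.
(* This turns the lower bound for the vertical gap, with [(2 * T) ^ (- q - 1)], into 8 times the
   quantity to be reached. *)
have e8 : (2 : R) `^ (- q - 1) = 8 * eps.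
  have -> : 8 = (2 : R) `^ 3 by rewrite powR_mulrn//; ring.
  by rewrite /eps -powRD_gt0//; congr powR; ring.
have [Qlo _] := powRN_sub_bounds (ltW q0) T0 Tt tt tT.
have [Plo Pup] := powRN_sub_bounds (ltW p0) T0 Tt tt tT.
move: Qlo; rewrite powRM ?(ltW T0)// e8 => Qlo.
have W0 : 0 <= T `^ (- q - 1) by exact: powR_ge0.
have P0 : 0 <= t `^ (- p) - t' `^ (- p).
  by rewrite subr_ge0; apply: powRN_le; lra.
have t'0 : 0 < t' by lra.
(* The horizontal coordinates carry the power [- p], the vertical ones [- q]; this factor passes
   from the first to the second. *)
have QP : t' `^ (- q) <= T `^ (- (q - p)) * t' `^ (- p).
  rewrite [leLHS](_ : _ = t' `^ (- (q - p)) * t' `^ (- p)).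
    by apply: ler_wpM2r; [exact: powR_ge0|apply: powRN_le; lra].
  by rewrite -powRD_gt0//; congr powR; ring.
have Tpq : T `^ (- (q - p)) <= 1.
  by rewrite -(powRr0 T); apply: ler_powR => //; lra.
have TW : T `^ (- (q - p)) * T `^ (- p - 1) = T `^ (- q - 1).
  by rewrite -powRD_gt0//; congr powR; ring.
have Tpq0 : 0 <= T `^ (- (q - p)) by exact: powR_ge0.
have Q'0 : 0 <= t' `^ (- q) by exact: powR_ge0.
have P'0 : 0 <= t' `^ (- p) by exact: powR_ge0.
(* The powers become plain variables, so that only polynomial inequalities remain. *)
move: (t `^ (- p)) (t' `^ (- p)) (t `^ (- q)) (t' `^ (- q)) (T `^ (- (q - p)))
  (T `^ (- p - 1)) (T `^ (- q - 1)) Qlo Pup W0 P0 QP Tpq TW Tpq0 Q'0 P'0 {Plo e8}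
  => P P' Q Q' Z V W Qlo Pup W0 P0 QP Z1 ZV Z0 Q'0 P'0.
set x := `|_ - _|; set y := `|_ - _ : R|.
have D0 : 0 <= t' - t by lra.
move: (t' - t) D0 Qlo Pup => D D0 Qlo Pup.
have x0 : 0 <= x by exact: normr_ge0.
(* Both points are on the unit circle, so [b' ^ 2 - b ^ 2 = a ^ 2 - a' ^ 2]; here [b + b' >= 1] and
   [a + a' <= 2 * eps]. *)
have bb : `|b' - b| <= 2 * eps * `|a' - a|.
  have e : (b' - b) * (b + b') = - ((a' - a) * (a + a')) by nra.
  have := congr1 Num.norm e; rewrite normrN !normrM (ger0_norm (x := b + b')); last lra.
  rewrite (ger0_norm (x := a + a')); last lra.
  have := normr_ge0 (b' - b); have := normr_ge0 (a' - a); nra.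
have Pa : P' * `|a' - a| <= x + V * p * D * eps.
  rewrite -(ger0_norm P'0) -normrM.
  have -> : P' * (a' - a) = (- (P * a) - - (P' * a')) + (P - P') * a by ring.
  apply: le_trans (ler_normD _ _) _; rewrite -/x lerD2l.
  by rewrite ger0_norm ?mulr_ge0//; nra.
have Qa : Q' * `|a' - a| <= x + W * p * D * eps.
  apply: (@le_trans _ _ (Z * (P' * `|a' - a|))).
    by rewrite mulrA ler_wpM2r.
  apply: (@le_trans _ _ (Z * (x + V * p * D * eps))); first by rewrite ler_wpM2l.
  rewrite mulrDr lerD//; last by rewrite !mulrA ZV.
  by rewrite ler_piMl.
have Qb : (Q - Q') * b <= y + Q' * `|b' - b|.
  have -> : (Q - Q') * b = (Q * b - Q' * b') + Q' * (b' - b) by ring.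
  by rewrite lerD ?ler_norm// ler_wpM2l// ler_norm.
have Qbb : Q' * `|b' - b| <= 2 * eps * (x + W * p * D * eps).
  apply: (@le_trans _ _ (Q' * (2 * eps * `|a' - a|))); first by rewrite ler_wpM2l.
  by rewrite mulrCA ler_wpM2l// ; lra.
have qW : p * eps * (W * D) <= q * eps * (W * D).
  by rewrite ler_wpM2r ?mulr_ge0// ler_wpM2r// ltW.
have WD : 0 <= W * D by exact: mulr_ge0.
have k1 : 2 * eps * x <= x by rewrite ler_piMl//; lra.
have k2 : 2 * eps * (W * p * D * eps) <= q * eps * (W * D).
  have -> : 2 * eps * (W * p * D * eps) = (2 * eps) * (p * eps * (W * D)) by ring.
  apply: le_trans qW; rewrite ler_piMl//; last by lra.
  by rewrite !mulr_ge0// ltW.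
(* Let the unit be [q * eps * (W * D)]. The vertical gap is 8 units, of which 4 remain since
   [b >= 1/2]. By [k1] and [k2] the errors are at most [x] plus one unit, so [x + y] is at least 3
   units. *)
have k3 : 4 * (q * eps * (W * D)) <= (Q - Q') * b.
  have k4 : 8 * (q * eps * (W * D)) <= Q - Q'.
    by apply: le_trans Qlo; rewrite le_eqVlt; apply/orP; left; apply/eqP; ring.
  have k5 : 0 <= q * eps * (W * D) by rewrite !mulr_ge0// ltW.
  apply: (@le_trans _ _ ((Q - Q') * (1/2))); first by lra.
  by rewrite ler_wpM2l//; lra.
have k5 : 0 <= q * eps * (W * D) by rewrite !mulr_ge0// ltW.
rewrite -mulrA; lra.
Qed.

(** * Arcs near the points where the curve is horizontal *)

Definition spiral_pt (R : realType) (p q t : R) : 'rV[R]_2 :=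
  \row_(j < 2) (if j == ord0 then t `^ (- p) * cos t else t `^ (- q) * sin t).

(* The time on the [k]-th turn, counted from the point where [cos] vanishes. *)
Definition arc_time (R : realType) (k : nat) (psi : R) : R :=
  psi + pi / 2 + pi *+ 2 *+ k.

Definition arc (R : realType) (p q eps : R) (k : nat) : set 'rV[R]_2 :=
  [set spiral_pt p q (arc_time k psi) | psi in [set psi : R | 0 <= psi <= eps]].

Lemma spiral_pt_x (R : realType) (p q t : R) :
  spiral_pt p q t ord0 ord0 = t `^ (- p) * cos t.
Proof. by rewrite mxE. Qed.

Lemma spiral_pt_y (R : realType) (p q t : R) :
  spiral_pt p q t ord0 ord_max = t `^ (- q) * sin t.
Proof. by rewrite mxE. Qed.

Lemma arc_timeE (R : realType) (k : nat) (psi : R) :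
  arc_time k psi = psi + pi / 2 + 2 * pi * k%:R.
Proof. by rewrite /arc_time -(mulr_natl pi 2) -(mulr_natr (2 * pi)). Qed.

Lemma cos_arc_time (R : realType) (k : nat) (psi : R) :
  cos (arc_time k psi) = - sin psi.
Proof. by rewrite /arc_time (periodicn (@cosD2pi R)) cosDpihalf. Qed.

Lemma sin_arc_time (R : realType) (k : nat) (psi : R) :
  sin (arc_time k psi) = cos psi.
Proof. by rewrite /arc_time (periodicn (@sinD2pi R)) sinDpihalf. Qed.

Lemma arc_sub_spiral (R : realType) (p q eps : R) (k : nat) :
  (0 < k)%N -> arc p q eps k `<=` elliptical_spiral p q.
Proof.
move=> k0 _ [psi /= /andP[psi0 _] <-]; exists (arc_time k psi) => //=.
have k1 : (1 : R) <= k%:R by rewrite ler1n.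
rewrite arc_timeE; have := pihalf_ge1 R; have := pi_ge2 R; nra.
Qed.

Lemma sin_ge0_le1 (R : realType) (x : R) : 0 <= x <= 1 -> 0 <= sin x.
Proof. by move=> /andP[x0 x1]; apply: sin_ge0_pi; have := pi_ge2 R; lra. Qed.

Lemma sin_gt0_le1 (R : realType) (x : R) : 0 < x <= 1 -> 0 < sin x.
Proof. by move=> /andP[x0 x1]; apply: sin_gt0_pi; have := pi_ge2 R; lra. Qed.

(** Intermediate value theorem: the abscissa is 0 at [psi = 0], and at [psi = eps] it is at most
    [- (T ^ (- p) * sin eps)], because the time there is at most [T]. *)
Lemma arc_proj (R : realType) (p q eps T : R) (k : nat) :
  0 <= p -> 0 <= eps <= 1 -> arc_time k eps <= T ->
  `[- (T `^ (- p) * sin eps), 0] `<=` (fun z : 'rV[R]_2 => z ord0 ord0) @` arc p q eps k.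
Proof.
move=> p0 /andP[e0 e1] kT v /=; rewrite in_itv/= => /andP[v1 v0].
pose x psi := spiral_pt p q (arc_time k psi) ord0 ord0.
have pos (psi : R) : 0 <= psi -> 0 < arc_time k psi.
  move=> h; rewrite arc_timeE; have k0 : (0 : R) <= 2 * pi * k%:R.
    by rewrite !mulr_ge0// pi_ge0.
  by have := pihalf_ge1 R; lra.
have cont : {within `[0, eps], continuous x}.
  apply: derivable_within_continuous => psi; rewrite in_itv/= => /andP[psi0 _].
  have h1 : is_derive psi 1 (arc_time k) 1.
    have -> : arc_time k = (@id R) + cst (pi / 2 + pi *+ 2 *+ k).
      by apply/funext => z; rewrite /arc_time/= /GRing.add/= addrA.
    have := is_deriveD (is_derive_id psi (1 : R))
      (is_derive_cst (pi / 2 + pi *+ 2 *+ k) psi (1 : R)).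
    by rewrite addr0.
  have h2 : is_derive psi 1 ((fun t : R => t `^ (- p)) \o arc_time k)
     ((- p * arc_time k psi `^ (- p - 1)) * 1).
    apply: (@is_derive1_comp _ (fun t : R => t `^ (- p))) => //.
    by apply: is_derive_powRN; exact: pos.
  have h3 : derivable (fun z => arc_time k z `^ (- p) * - sin z) psi 1.
    apply: derivableM; first by case: h2.
    by apply: derivableN; exact: derivable_sin.
  have -> : x = (fun z => arc_time k z `^ (- p) * - sin z) => //.
  by apply/funext => z; rewrite /x spiral_pt_x cos_arc_time.
have x0 : x 0 = 0 by rewrite /x spiral_pt_x cos_arc_time sin0 oppr0 mulr0.
have s0 : 0 <= sin eps by apply: sin_ge0_le1; rewrite e0.
have xe : x eps <= v.
  apply: le_trans v1; rewrite /x spiral_pt_x cos_arc_time mulrN lerN2.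
  by apply: ler_wpM2r => //; apply: powRN_le => //; exact: pos.
have [|psi psiI psiv] := @IVT R x 0 eps v e0 cont.
  by rewrite x0 ge_min le_max xe v0 orbT.
move: psiI; rewrite in_itv/= => psiI.
by exists (spiral_pt p q (arc_time k psi)) => //; exists psi.
Qed.

(** The points of [U] on the two arcs are at least [j - i] apart in time, so [arc_gap] bounds from
    below the sum of their coordinate differences. Each difference is at most the diameter, whence
    the factor 2. *)
Lemma arc_fst_sep (R : realType) (p q T : R) (i j : nat) (U : set 'rV[R]_2) :
  let eps := (2 : R) `^ (- (q + 4)) in
  0 < p -> p <= q -> 1 <= T -> (i <= j)%N ->
  T <= arc_time i 0 -> arc_time j 1 <= 2 * T ->
  diam U \is a fin_num ->
  U `&` arc p q eps i !=set0 -> U `&` arc p q eps j !=set0 ->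
  (j - i)%:R <= 2 * fine (diam U) / (q * eps * T `^ (- q - 1)).
Proof.
move=> eps p0 pq T1 ij Ti jT fU.
have e0 : 0 < eps by exact: powR_gt0.
have e1 : eps <= 1/2 by apply: powR2N_le_half; lra.
move=> [z [Uz [psi /= /andP[psi0 psie] zE]]] [z' [Uz' [psi' /= /andP[psi0' psie'] zE']]].
have d0 : 0 <= fine (diam U) by rewrite fine_ge0// diam_ge0.
have c0 : 0 < q * eps * T `^ (- q - 1).
  by rewrite !mulr_gt0 ?powR_gt0//; lra.
(* On a single turn the times may come in either order, so [i = j] is treated apart. *)
move: ij; rewrite leq_eqVlt => /orP[/eqP->|ij].
  by rewrite subnn; apply: divr_ge0; [exact: mulr_ge0|exact: ltW].
rewrite ler_pdivlMr// mulrC.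
(* Each turn contributes [2 * pi >= 4], which outweighs [psi' - psi >= - 1/2]. *)
have D : (j - i)%:R <= arc_time j psi' - arc_time i psi.
  have ij1 : (1 : R) <= (j - i)%:R by rewrite ler1n subn_gt0.
  have -> : arc_time j psi' - arc_time i psi = psi' - psi + 2 * pi * (j - i)%:R.
    by rewrite !arc_timeE natrB ?(ltnW ij)//; ring.
  have : 2 * 2 * (j - i)%:R <= 2 * pi * (j - i)%:R :> R.
    by rewrite ler_wpM2r// ler_wpM2l// pi_ge2.
  lra.
have halfcos (x : R) : 0 <= x <= eps -> 1/2 <= cos x.
  move=> /andP[xx0 xx1]; have c : 0 <= cos x.
    by apply: cos_ge0_pihalf; have := pihalf_ge1 R; lra.
  have sx := sin_le_id xx0; have sx0 : 0 <= sin x by apply: sin_ge0_le1; lra.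
  have := cos2Dsin2 x; rewrite leNgt => h; apply/negP => c1; nra.
have sinb (x : R) : 0 <= x <= eps -> 0 <= sin x <= eps.
  move=> /andP[xx0 xx1]; have sx := sin_le_id xx0.
  by rewrite sin_ge0_le1 ?(le_trans sx)// xx0/=; lra.
have := @arc_gap R p q T (arc_time i psi) (arc_time j psi') (sin psi) (cos psi)
  (sin psi') (cos psi') p0 pq T1.
have arcm k (u v : R) : u <= v -> arc_time k u <= arc_time k v by rewrite !arc_timeE; lra.
rewrite -/eps => /(_ (le_trans Ti (arcm _ _ _ psi0))).
have tt : arc_time i psi <= arc_time j psi'.
  by rewrite -subr_ge0 (le_trans _ D)// ler0n.
have le1 : psi' <= 1 by lra.
move=> /(_ tt (le_trans (arcm _ _ _ le1) jT)).
have I1 : 0 <= psi <= eps by rewrite psi0.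
have I2 : 0 <= psi' <= eps by rewrite psi0'.
move=> /(_ (sinb _ I1) (sinb _ I2) (halfcos _ I1) (halfcos _ I2)).
rewrite ![sin _ ^+ 2 + _]addrC !cos2Dsin2 => /(_ erefl erefl) gap.
have := coord_le_diam ord0 fU Uz Uz'; have := coord_le_diam ord_max fU Uz Uz'.
rewrite -zE -zE' !spiral_pt_x !spiral_pt_y !cos_arc_time !sin_arc_time !mulrN.
move=> hy hx.
apply: le_trans (_ : q * eps * T `^ (- q - 1) * (arc_time j psi' - arc_time i psi) <= _).
  by rewrite ler_wpM2l// ltW.
apply: le_trans gap _; lra.
Qed.

(** * Lower bounds for the sums of diameters *)

Lemma esumZl (R : realType) (I : set nat) (k : R) (f : nat -> \bar R) :
  0 <= k -> (forall i, 0 <= f i)%E ->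
  (\esum_(i in I) (k%:E * f i) = k%:E * \esum_(i in I) f i)%E.
Proof.
move=> k0 f0; have nn (g : nat -> \bar R) : (forall i, 0 <= g i)%E ->
    (\esum_(i in I) g i = \sum_(i <oo | i \in I) g i)%E.
  by move=> g0; rewrite nneseries_esum// set_mem_set.
rewrite !nn// ?nneseriesZl// => i; exact: mule_ge0.
Qed.

Lemma diam_sum_ge (R : realType) (n : nat) (s K l : R) (I : set nat)
    (U : nat -> set 'rV[R]_n) (g : nat -> R) :
  0 < K -> (forall i, I i -> diam (U i) \is a fin_num) ->
  (forall i, I i -> g i <= K * fine (diam (U i)) `^ s) ->
  (l%:E <= \esum_(i in I) (g i)%:E)%E -> ((l / K)%:E <= diam_sum s I U)%E.
Proof.
move=> K0 fU gK lg.
rewrite mulrC EFinM lee_pdivrMl//; apply: le_trans lg _.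
rewrite /diam_sum -esumZl ?(ltW K0)//; last by move=> i; exact: poweR_ge0.
apply: le_esum => i Ii.
by rewrite -[diam (U i)]fineK ?fU// poweR_EFin -EFinM lee_fin gK.
Qed.

(** The first bound uses [d >= delta]: then [d ^ (- a) <= m]. The second uses [d <= delta ^ theta]:
    the factor [m ^ (p + q)] is of order [delta ^ (- a (p + q))], and by the equation for [a] the
    factor [d ^ (1 - a (1 - p))] is at most [delta ^ (a (p + q))], so the two cancel. *)
Lemma scale_bounds (R : realType) (p q theta a delta d m : R) :
  0 < p -> p < 1 -> p <= q -> 0 <= theta ->
  0 <= a -> a * (1 - p) <= 1 -> a * (p + q) = theta * (1 - a * (1 - p)) ->
  0 < delta -> delta <= 1 -> delta <= d -> d <= delta `^ theta ->
  delta `^ (- a) <= m -> m <= 2 * delta `^ (- a) ->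
  d <= m `^ (1 - p) * d `^ (1 + a * (1 - p)) /\
  d ^+ 2 * m `^ (q + 1) <= 2 `^ (p + q) * m `^ (1 - p) * d `^ (1 + a * (1 - p)).
Proof.
move=> p0 p1 pq th0 a0 ap apq de0 de1 ded dde m1 m2.
have d0 : 0 < d by exact: lt_le_trans ded.
have mpos : 0 < m by apply: lt_le_trans m1; exact: powR_gt0.
have dm : d `^ (- a) <= m by apply: le_trans m1; exact: powRN_le.
have p1' : 0 <= 1 - p by lra.
split.
  apply: le_trans (_ : (d `^ (- a)) `^ (1 - p) * d `^ (1 + a * (1 - p)) <= _).
    rewrite -powRrM -powRD_gt0// [X in d `^ X](_ : _ = 1); last by ring.
    by rewrite powRr1// ltW.
  apply: ler_wpM2r; first exact: powR_ge0.
  by apply: ge0_ler_powR => //; rewrite nnegrE ?powR_ge0// ltW.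
have pq0 : 0 <= p + q by lra.
have s2 : 0 <= 1 - a * (1 - p) by lra.
have e1 : m `^ (p + q) <= 2 `^ (p + q) * delta `^ (- (a * (p + q))).
  apply: le_trans (_ : (2 * delta `^ (- a)) `^ (p + q) <= _).
    by apply: ge0_ler_powR => //; rewrite nnegrE ?mulr_ge0 ?powR_ge0// ltW.
  by rewrite powRM ?powR_ge0// -powRrM mulNr.
have e2 : d `^ (1 - a * (1 - p)) <= delta `^ (a * (p + q)).
  rewrite apq powRrM; apply: ge0_ler_powR => //; rewrite nnegrE ?powR_ge0// ltW//.
have e3 : delta `^ (- (a * (p + q))) * delta `^ (a * (p + q)) = 1.
  by rewrite -powRD_gt0// addrC subrr powRr0.
have -> : d ^+ 2 * m `^ (q + 1) =
   m `^ (p + q) * d `^ (1 - a * (1 - p)) * m `^ (1 - p) * d `^ (1 + a * (1 - p)).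
  rewrite -powR_mulrn ?(ltW d0)//.
  have -> : q + 1 = (p + q) + (1 - p) by ring.
  rewrite (powRD_gt0 _ _ mpos).
  have -> : (2%:R : R) = (1 - a * (1 - p)) + (1 + a * (1 - p)) by ring.
  by rewrite (powRD_gt0 _ _ d0); ring.
apply: ler_wpM2r; first exact: powR_ge0.
apply: ler_wpM2r; first exact: powR_ge0.
apply: le_trans (_ : 2 `^ (p + q) * delta `^ (- (a * (p + q))) * delta `^ (a * (p + q)) <= _).
  by apply: ler_pM => //; exact: powR_ge0.
by rewrite -mulrA e3 mulr1.
Qed.

Lemma le_fin_num_diam (R : realType) (n : nat) (U : set 'rV[R]_n) (r : R) :
  (diam U <= r%:E)%E -> diam U \is a fin_num /\ fine (diam U) <= r.
Proof.
move=> Ur; have fU : diam U \is a fin_num.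
  by rewrite ge0_fin_numE ?diam_ge0// (le_lt_trans Ur)// ltry.
by split => //; rewrite -lee_fin fineK.
Qed.

(** A single arc suffices: its projection has positive length, and [d <= d ^ s] for [d <= 1] and
    [s <= 1]. The diameters need no lower bound, so the estimate also serves the Hausdorff
    measure. *)
Lemma spiral_diam_sum_ge_le1 (R : realType) (p q : R) : 0 < p -> p <= q ->
  exists2 c : R, 0 < c & forall (s : R) I U, s <= 1 ->
    is_cover (elliptical_spiral p q) I U ->
    (forall i, I i -> (diam (U i) <= 1%:E)%E) ->
    (c%:E <= diam_sum s I U)%E.
Proof.
move=> p0 pq; pose T : R := arc_time 1 1; pose l := T `^ (- p) * sin 1.
have T0 : 0 < T.
  by rewrite /T arc_timeE; have := pihalf_ge1 R; lra.
have l0 : 0 < l by rewrite mulr_gt0 ?powR_gt0 ?sin_gt0_le1 ?ltr01/=.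
exists (l / 2); first by rewrite divr_gt0.
move=> s I U s1 cov U1.
have fU i : I i -> diam (U i) \is a fin_num by move=> /U1/le_fin_num_diam[].
have fU1 i : I i -> fine (diam (U i)) <= 1 by move=> /U1/le_fin_num_diam[].
have p0' := ltW p0.
have := @arcs_cover_sum R _ 1 (fun=> arc p q 1 1) l I U (fun=> 0) (ltW l0) cov.
rewrite mul1r; move=> H; apply: diam_sum_ge (H _ _ _ _ _) => //.
- move=> i Ii; rewrite addr0 mulr1 ler_wpM2l//.
  have : 0 <= fine (diam (U i)) by rewrite fine_ge0// diam_ge0.
  rewrite le_eqVlt => /orP[/eqP <-|d0]; first exact: powR_ge0.
  by apply: ger1_powR => //; rewrite d0 fU1.
- by move=> k _; exact: arc_sub_spiral.
- by move=> k _; apply: arc_proj => //; rewrite ler01 lexx.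
- move=> i k j _; rewrite ltnS leqn0 => /andP[kj /eqP j0].
  by move: kj; rewrite j0 leqn0 => /eqP ->.
Qed.

(** The total length of the projections is [c1 * m ^ (1 - p)], and each covering set contributes at
    most [K * m ^ (1 - p) * d ^ s]. The powers of [m] cancel, which leaves a constant independent of
    [delta]. *)
Lemma spiral_diam_sum_ge (R : realType) (p q theta a : R) :
  0 < p -> p < 1 -> p <= q -> 0 <= theta -> 0 <= a -> a * (1 - p) <= 1 ->
  a * (p + q) = theta * (1 - a * (1 - p)) ->
  exists2 c : R, 0 < c & forall (s delta : R) I U, s <= 1 + a * (1 - p) ->
    0 < delta -> delta <= 1 ->
    is_cover (elliptical_spiral p q) I U ->
    (forall i, I i -> (delta%:E <= diam (U i) <= (delta `^ theta)%:E)%E) ->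
    (c%:E <= diam_sum s I U)%E.
Proof.
move=> p0 p1 pq th0 a0 ap apq.
pose eps := (2 : R) `^ (- (q + 4)).
have e0 : 0 < eps by exact: powR_gt0.
have e1 : eps <= 1/2 by apply: powR2N_le_half; lra.
have pi2 : 2 <= pi :> R by exact: pi_ge2.
have q0 : 0 < q by lra.
(* Chosen so that [X i = C2 * d * m ^ (q + 1)], where [d] is the diameter of [U i]. *)
pose C2 := 2 / (q * eps * (2 * pi) `^ (- q - 1)).
have C20 : 0 <= C2.
  by rewrite divr_ge0// !mulr_ge0 ?powR_ge0// ltW.
pose K := 2 * (1 + C2 * 2 `^ (p + q)).
have K0 : 0 < K.
  by rewrite mulr_gt0// ltr_pwDl// mulr_ge0// powR_ge0.
pose c1 := (2 * (2 * pi)) `^ (- p) * sin eps.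
have c10 : 0 < c1.
  by rewrite mulr_gt0 ?powR_gt0 ?sin_gt0_le1//; lra.
exists (c1 / K); first by rewrite divr_gt0.
move=> s delta I U sle d0 d1 cov Ud.
have fU i : I i -> diam (U i) \is a fin_num.
  by move=> /Ud/andP[_ /le_fin_num_diam[]].
have fUge i : I i -> delta <= fine (diam (U i)).
  by move=> Ii; have /andP[h _] := Ud i Ii; rewrite -lee_fin fineK// fU.
have fUle i : I i -> fine (diam (U i)) <= delta `^ theta.
  by move=> /Ud/andP[_ /le_fin_num_diam[]].
have dth : delta `^ theta <= 1.
  by rewrite -(powRr0 delta); apply: ger_powR => //; rewrite d0.
pose x := delta `^ (- a).
have x1 : 1 <= x.
  by rewrite -(powRr0 delta); apply: ger_powR; rewrite ?d0// oppr_le0.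
(* Rounding up, with [x >= 1], gives [x <= m <= 2 * x]. *)
pose M := (Num.truncn x).+1; pose m : R := M%:R.
have xm : x <= m by apply: ltW; exact: truncnS_gt.
have m2x : m <= 2 * x.
  have : (Num.truncn x)%:R <= x by rewrite truncn_le; lra.
  rewrite /m /M -addn1 natrD; lra.
have m0 : 0 < m by lra.
have m1 : 1 <= m by lra.
(* The turns [M, ..., 2 M - 1] are used; their arcs have times in [[T, 2 * T]], the last one because
   [1 + pi / 2 <= 2 * pi]. *)
pose T := 2 * pi * m.
have T1 : 1 <= T by rewrite /T; nra.
pose l := (2 * T) `^ (- p) * sin eps.
have l0 : 0 <= l by rewrite mulr_ge0 ?powR_ge0// ltW// sin_gt0_le1//; lra.
have klt (k : nat) : (k < M)%N -> arc_time (M + k) 1 <= 2 * T.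
  move=> kM; have k1 : (k%:R : R) <= m - 1.
    by rewrite lerBrDr natr1 ler_nat.
  have : 2 * pi * k%:R <= 2 * pi * (m - 1) by rewrite ler_wpM2l// mulr_ge0// pi_ge0.
  have h : 1 + pi / 2 <= 2 * pi :> R by lra.
  by rewrite arc_timeE natrD -/m /T; lra.
pose X i := 2 * fine (diam (U i)) / (q * eps * T `^ (- q - 1)).
have dpos i : 0 <= fine (diam (U i)) by rewrite fine_ge0// diam_ge0.
have X0 i : 0 <= X i.
  rewrite divr_ge0//; first by rewrite mulr_ge0.
  by rewrite !mulr_ge0 ?powR_ge0// ltW.
have arcm k (u v : R) : u <= v -> arc_time k u <= arc_time k v by rewrite !arc_timeE; lra.
have H := @arcs_cover_sum R _ M (fun k => arc p q eps (M + k)) l I U X l0 cov.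
have mE : m * l = c1 * m `^ (1 - p).
  rewrite /l /c1 (_ : 2 * T = 2 * (2 * pi) * m); last by rewrite /T; ring.
  rewrite powRM ?(ltW m0) ?mulr_ge0 ?pi_ge0// (powRD_gt0 _ _ m0) powRr1 ?(ltW m0)//.
  by ring.
have mp0 : 0 < m `^ (1 - p) by exact: powR_gt0.
rewrite (_ : c1 / K = (m * l) / (K * m `^ (1 - p))); last first.
  by rewrite mE [in RHS]invfM [RHS]mulrACA divff ?mulr1// gt_eqF.
apply: diam_sum_ge (H _ _ _ _ _) => //.
- by rewrite mulr_gt0// powR_gt0.
- move=> i Ii; have [h1 h2] := scale_bounds p0 p1 pq th0 a0 ap apq d0 d1
    (fUge i Ii) (fUle i Ii) xm m2x.
  have di0 : 0 < fine (diam (U i)) by apply: lt_le_trans (fUge i Ii).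
  have XE : X i = C2 * (fine (diam (U i)) * m `^ (q + 1)).
    rewrite /X /C2 /T (powRM (x := 2 * pi)) ?(ltW m0) ?mulr_ge0 ?pi_ge0//.
    rewrite [in m `^ (- q - 1)](_ : - q - 1 = - (q + 1)); last by ring.
    by rewrite (powRN m) !invfM invrK; ring.
  (* Since [d <= 1], it is enough to treat the largest exponent [1 + a * (1 - p)]. *)
  apply: le_trans
    (_ : K * m `^ (1 - p) * fine (diam (U i)) `^ (1 + a * (1 - p)) <= _); last first.
    apply: ler_wpM2l; first by rewrite mulr_ge0 ?powR_ge0// ltW.
    by apply: ger_powR => //; rewrite di0/= (le_trans (fUle i Ii)).
  have -> : 2 * fine (diam (U i)) * (1 + X i) =
      2 * (fine (diam (U i)) + C2 * (fine (diam (U i)) ^+ 2 * m `^ (q + 1))).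
    by rewrite XE; ring.
  have -> : K * m `^ (1 - p) * fine (diam (U i)) `^ (1 + a * (1 - p)) =
    2 * (m `^ (1 - p) * fine (diam (U i)) `^ (1 + a * (1 - p)) +
      C2 * (2 `^ (p + q) * m `^ (1 - p) * fine (diam (U i)) `^ (1 + a * (1 - p)))).
    by rewrite /K; ring.
  by rewrite ler_wpM2l// lerD// ler_wpM2l.
- by move=> k kM; apply: arc_sub_spiral; rewrite addSn.
- move=> k kM; apply: arc_proj; [exact: ltW| lra |].
  by apply: le_trans (klt _ kM); apply: arcm; lra.
- move=> i k j Ii /andP[kj jM].
  have -> : (j - k = (M + j) - (M + k))%N by rewrite subnDl.
  apply: arc_fst_sep => //.
  + by rewrite leq_add2l.
  + rewrite arc_timeE natrD -/m /T; have : 0 <= 2 * pi * k%:R :> R.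
      by rewrite !mulr_ge0// pi_ge0.
    by have := pihalf_ge1 R; lra.
  + exact: klt.
  + exact: fU.
Qed.

(** * Covers by squares *)

(* The side is [r / sqrt 2], so that the diameter is exactly [r]. *)
Definition square (R : realType) (r : R) (c : R * R) : set 'rV[R]_2 :=
  [set z | c.1 <= z ord0 ord0 <= c.1 + r / Num.sqrt 2 /\
           c.2 <= z ord0 ord_max <= c.2 + r / Num.sqrt 2].

Lemma edist2E (R : realType) (x y : 'rV[R]_2) :
  Defs.edist x y = Num.sqrt ((x ord0 ord0 - y ord0 ord0) ^+ 2 +
    (x ord0 ord_max - y ord0 ord_max) ^+ 2).
Proof.
rewrite /Defs.edist big_ord_recl big_ord1.
by rewrite (_ : lift ord0 ord0 = ord_max)//; apply: val_inj.
Qed.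

(** The diameter is attained at the opposite corners [lo] and [hi]. *)
Lemma diam_square (R : realType) (r : R) (c : R * R) : 0 <= r ->
  diam (square r c) = r%:E.
Proof.
move=> r0; have s0 : 0 < Num.sqrt 2 :> R by rewrite sqrtr_gt0.
pose h := r / Num.sqrt 2.
have h0 : 0 <= h by rewrite divr_ge0// ltW.
have hh : h ^+ 2 + h ^+ 2 = r ^+ 2.
  by rewrite /h exprMn exprVn sqr_sqrtr//; field.
apply/eqP; rewrite eq_le; apply/andP; split.
  apply: ge_ereal_sup => _ [->|[[x y] /= [[/andP[x1 x2] /andP[x3 x4]]
      [/andP[y1 y2] /andP[y3 y4]]] <-]]; first by rewrite lee_fin.
  rewrite lee_fin edist2E -[leRHS]ger0_norm// -sqrtr_sqr ler_wsqrtr// -hh.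
  rewrite -/h in x2 x4 y2 y4.
  by apply: lerD; rewrite -[leLHS]real_normK ?num_real// ler_sqr ?nnegrE// ler_norml;
    apply/andP; split; lra.
pose lo : 'rV[R]_2 := \row_(j < 2) (if j == ord0 then c.1 else c.2).
pose hi : 'rV[R]_2 := \row_(j < 2) (if j == ord0 then c.1 + h else c.2 + h).
rewrite [leLHS](_ : _ = (Defs.edist hi lo)%:E).
  apply: edist_le_diam; rewrite /square/= !mxE/= -/h; split; lra.
rewrite edist2E !mxE/= ![_ + h]addrC !addrK hh sqrtr_sqr ger0_norm//.
Qed.

(** An entry of [l] consists of the diameter of a square and its lower left corner. Finite lists
    suffice for all covers of the upper bound. *)
Lemma has_theta_cover_squares (R : realType) (theta s eps delta : R)
    (E : set 'rV[R]_2) (l : seq (R * (R * R))) :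
  0 <= delta ->
  (forall c, c \in l -> delta <= c.1 <= delta `^ theta) ->
  (forall z, E z -> exists2 c, c \in l & square c.1 c.2 z) ->
  \sum_(c <- l) c.1 `^ s <= eps ->
  has_theta_cover theta s eps delta E.
Proof.
move=> d0 ld lE sle; pose x0 : R * (R * R) := (0, (0, 0)).
pose U i := square (nth x0 l i).1 (nth x0 l i).2.
have dU i : (i < size l)%N -> diam (U i) = ((nth x0 l i).1)%:E.
  move=> il; rewrite diam_square//.
  by have /andP[h _] := ld _ (mem_nth x0 il); exact: le_trans h.
exists `I_(size l), U; split.
- move=> z /lE[c cl cz]; exists (index c l); first by rewrite /= index_mem.
  by rewrite /U nth_index.
- by move=> i /= il; rewrite dU// !lee_fin ld// mem_nth.
- rewrite /diam_sum esum_fset//; last by move=> i _; exact: poweR_ge0.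
  rewrite -fsbig_ord (eq_bigr (fun i : 'I_(size l) => ((nth x0 l i).1 `^ s)%:E)).
    by rewrite sumEFin lee_fin (le_trans _ sle)// (big_nth x0) big_mkord.
  by move=> i _; rewrite dU// poweR_EFin.
Qed.

(** The cell is found by truncating [(v - v0) / h]; the extra cell accommodates the right end of the
    interval. *)
Lemma grid_point (R : realType) (h v0 len v : R) : 0 < h -> v0 <= v <= v0 + len ->
  exists2 j, (j < (Num.truncn (len / h)).+1)%N &
    v0 + j%:R * h <= v <= v0 + j%:R * h + h.
Proof.
move=> h0 /andP[v1 v2]; pose w := (v - v0) / h.
have w0 : 0 <= w by rewrite divr_ge0 ?subr_ge0// ltW.
have vE : v = v0 + w * h by rewrite /w divfK ?gt_eqF//; ring.
exists (Num.truncn w).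
  by rewrite ltnS; apply: le_truncn; rewrite ler_pM2r ?invr_gt0//; lra.
have /andP[t1 t2] := truncn_itv w0.
have k1 : (Num.truncn w)%:R * h <= w * h by rewrite ler_pM2r.
have k2 : w * h <= ((Num.truncn w)%:R + 1) * h.
  by rewrite ler_pM2r// natr1 ltW.
by rewrite vE; lra.
Qed.

Lemma sum_powR_const_fst (R : realType) (l : seq (R * (R * R))) (r s : R) :
  (forall c, c \in l -> c.1 = r) -> \sum_(c <- l) c.1 `^ s = (size l)%:R * r `^ s.
Proof.
move=> lr; rewrite big_seq (eq_bigr (fun=> r `^ s)) => [|c /lr -> //].
by rewrite -big_seq big_const_seq count_predT iter_addr_0 mulr_natl.
Qed.

(* In the variable [t ^ (1 - p)] the speed of the curve is bounded. *)
Lemma powR_trig_lipschitz (R : realType) (f f' : R -> R) (p r u v : R) :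
  (forall x : R, is_derive x 1 f (f' x)) ->
  (forall x, `|f x| <= 1) -> (forall x, `|f' x| <= 1) ->
  0 < p < 1 -> p <= r -> 1 <= u -> u <= v ->
  `|(v `^ (1 - p)^-1) `^ (- r) * f (v `^ (1 - p)^-1) -
    (u `^ (1 - p)^-1) `^ (- r) * f (u `^ (1 - p)^-1)| <=
  (r + 1) * (1 - p)^-1 * (v - u).
Proof.
move=> df f1 f'1 /andP[p0 p1] pr u1 uv.
set b := (1 - p)^-1.
have b0 : 0 < b by rewrite invr_gt0; lra.
(* With [t = u ^ b], the derivative of [u ^ b] is thus [b * t ^ p], which compensates the decay
   [t ^ (- p)] of [h'] found in [hb]. *)
have bp : b - 1 = b * p.
  rewrite /b; have : (1 - p)^-1 * (1 - p) = 1 by rewrite mulVf//; apply: lt0r_neq0; lra.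
  by move=> e; rewrite -[X in _ - X]e; ring.
pose h t := t `^ (- r) * f t.
pose h' t := t `^ (- r) * f' t + (- r * t `^ (- r - 1)) * f t.
have dh (t : R) : 0 < t -> is_derive t 1 h (h' t).
  move=> t0; rewrite /h /h'.
  have := is_deriveM (is_derive_powRN r t0) (df t).
  move=> H; apply: (is_derive_eq H); rewrite /GRing.scale/=; ring.
pose g x := h (x `^ b).
have dg (x : R) : 0 < x -> is_derive x 1 g (h' (x `^ b) * (b * x `^ (b - 1))).
  move=> x0; apply: (@is_derive1_comp _ h (fun x => x `^ b)).
  - by apply: dh; exact: powR_gt0.
  - exact: is_derive1_powR.
have cont : {within `[u, v], continuous g}.
  apply: derivable_within_continuous => x; rewrite in_itv/= => /andP[ux _].
  by have [] := dg x (lt_le_trans ltr01 (le_trans u1 ux)).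
have I (x : R) : x \in `]u, v[ -> is_derive x 1 g (h' (x `^ b) * (b * x `^ (b - 1))).
  rewrite in_itv/= => /andP[ux _]; apply: dg; lra.
have [c] := @MVT_segment R g _ u v uv I cont.
rewrite in_itv/= => /andP[uc cv] E.
rewrite [X in `|X|](_ : _ = g v - g u)// E normrM (ger0_norm (x := v - u)); last by lra.
apply: ler_wpM2r; first by lra.
set t := c `^ b.
have t1 : 1 <= t by apply: powR_ge1; lra.
have -> : c `^ (b - 1) = t `^ p by rewrite bp powRrM.
have t0 : 0 < t by lra.
rewrite normrM [X in _ * X]ger0_norm; last by rewrite mulr_ge0 ?powR_ge0// ltW.
have tp : t `^ (- p) * t `^ p = 1 by rewrite -powRD_gt0// addrC subrr powRr0.
have hb : `|h' t| <= (r + 1) * t `^ (- p).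
  have a1 : `|t `^ (- r) * f' t| <= t `^ (- p).
    rewrite normrM ger0_norm ?powR_ge0//.
    apply: le_trans (_ : t `^ (- r) * 1 <= _); first by rewrite ler_wpM2l ?powR_ge0.
    by rewrite mulr1 ler_powR// lerN2.
  have a2 : `|- r * t `^ (- r - 1) * f t| <= r * t `^ (- p).
    rewrite !normrM normrN (ger0_norm (x := r)); last by lra.
    rewrite (ger0_norm (powR_ge0 _ _)) -mulrA; apply: ler_wpM2l; first by lra.
    apply: le_trans (_ : t `^ (- r - 1) * 1 <= _); first by rewrite ler_wpM2l ?powR_ge0.
    by rewrite mulr1 ler_powR//; lra.
  by apply: le_trans (ler_normD _ _) _; rewrite mulrDl mul1r addrC lerD.
apply: le_trans (_ : (r + 1) * t `^ (- p) * (b * t `^ p) <= _).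
  by apply: ler_wpM2r => //; rewrite mulr_ge0 ?powR_ge0// ltW.
by rewrite mulrACA tp mulr1.
Qed.

Lemma truncnS_le (R : realType) (x : R) : 0 <= x -> (Num.truncn x).+1%:R <= x + 1.
Proof. by move=> x0; rewrite -natr1 lerD2r truncn_le. Qed.

(** Both coordinates are Lipschitz in [u] with constant [L], so a square centred at a curve point
    covers a fixed step in [u]. Keeping [p'] apart from [p] allows [p >= 1]. *)
Lemma curve_squares (R : realType) (p' p q : R) : 0 < p' < 1 -> p' <= p -> p <= q ->
  exists2 C : R, 0 <= C & forall W delta : R, 1 <= W -> 0 < delta ->
    exists l : seq (R * (R * R)),
      [/\ forall c, c \in l -> c.1 = delta,
          forall u, 1 <= u <= W -> exists2 c, c \in l &
            square c.1 c.2 (spiral_pt p q (u `^ (1 - p')^-1))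
        & (size l)%:R <= C * W / delta + 1].
Proof.
move=> p'01 p'p pq; have /andP[p'0 p'1] := p'01.
set b := (1 - p')^-1.
have b0 : 0 < b by rewrite invr_gt0; lra.
pose L := (q + 1) * b.
have L0 : 0 < L by rewrite mulr_gt0//; lra.
have s0 : 0 < Num.sqrt 2 :> R by rewrite sqrtr_gt0.
exists (Num.sqrt 2 * (2 * L)).
  by apply: mulr_ge0; [exact: ltW|apply: mulr_ge0 => //; exact: ltW].
move=> W delta W1 d0.
(* [h] is the side of the squares, and the step [D] satisfies [L * D = h / 2], half a side. *)
pose h := delta / Num.sqrt 2; pose D := h / (2 * L).
have h0 : 0 < h by rewrite divr_gt0.
have D0 : 0 < D by rewrite divr_gt0// mulr_gt0.
pose pt u : 'rV[R]_2 := spiral_pt p q (u `^ b).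
pose N := (Num.truncn ((W - 1) / D)).+1.
exists [seq (delta, (pt (1 + j%:R * D) ord0 ord0 - h / 2,
                     pt (1 + j%:R * D) ord0 ord_max - h / 2)) | j <- iota 0 N].
split.
- by move=> c /mapP[j _ ->].
- move=> u /andP[u1 uW].
  have [|j jN /andP[ju uj]] := @grid_point R D 1 (W - 1) u D0.
    by rewrite u1/=; lra.
  set uj0 := 1 + j%:R * D in ju uj.
  have uj1 : 1 <= uj0 by rewrite lerDl mulr_ge0// ltW.
  have LD : L * (u - uj0) <= h / 2.
    apply: le_trans (_ : L * D <= _); first by rewrite ler_wpM2l; lra.
    by rewrite le_eqVlt; apply/orP; left; apply/eqP; rewrite /D; field; rewrite gt_eqF.
  have ball_itv (x c : R) : `|x - c| <= h / 2 -> c - h / 2 <= x <= c - h / 2 + h.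
    by rewrite ler_norml => /andP[? ?]; apply/andP; split; lra.
  have lip (r : R) f f' : (forall x : R, is_derive x 1 f (f' x)) ->
      (forall x, `|f x| <= 1) -> (forall x, `|f' x| <= 1) -> p' <= r -> r <= q ->
      `|(u `^ b) `^ (- r) * f (u `^ b) -
        (uj0 `^ b) `^ (- r) * f (uj0 `^ b)| <= h / 2.
    move=> df f1 f1' pr rq; apply: le_trans LD.
    apply: le_trans (powR_trig_lipschitz df f1 f1' p'01 pr uj1 ju) _.
    by rewrite ler_wpM2r ?subr_ge0// ler_wpM2r ?(ltW b0)//; lra.
  eexists; first by apply/mapP; exists j; [rewrite mem_iota add0n leq0n|reflexivity].
  rewrite /square/= /pt !spiral_pt_x !spiral_pt_y -/h -/uj0.
  have := lip p cos (fun x => - sin x) (@is_derive_cos R) (@cos_max R).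
  have sinN1 (x : R) : `|- sin x| <= 1 by rewrite normrN sin_max.
  move=> /(_ sinN1 p'p pq).
  have := lip q sin cos (@is_derive_sin R) (@sin_max R) (@cos_max R)
    (le_trans p'p pq) (lexx q).
  by move=> Hy Hx; split; exact: ball_itv.
- rewrite size_map size_iota; apply: le_trans (truncnS_le _) _.
    by rewrite divr_ge0 ?subr_ge0// ltW.
  rewrite lerD2r (_ : _ / delta = W / D).
    by rewrite ler_wpM2r// ?invr_ge0 ?(ltW D0)//; lra.
  by rewrite /D /h; field; rewrite !gt_eqF.
Qed.

Lemma rectangle_squares (R : realType) (A B r : R) : 0 <= A -> 0 <= B -> 0 < r ->
  exists l : seq (R * (R * R)),
    [/\ forall c, c \in l -> c.1 = r,
        forall z : 'rV[R]_2, `|z ord0 ord0| <= A -> `|z ord0 ord_max| <= B ->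
          exists2 c, c \in l & square c.1 c.2 z
      & (size l)%:R <= (2 * Num.sqrt 2 * A / r + 1) * (2 * Num.sqrt 2 * B / r + 1)].
Proof.
move=> A0 B0 r0.
have s0 : 0 < Num.sqrt 2 :> R by rewrite sqrtr_gt0.
pose h := r / Num.sqrt 2.
have h0 : 0 < h by rewrite divr_gt0.
pose n1 := (Num.truncn (2 * A / h)).+1; pose n2 := (Num.truncn (2 * B / h)).+1.
exists [seq (r, (- A + i%:R * h, - B + j%:R * h)) | i <- iota 0 n1, j <- iota 0 n2].
split.
- by move=> c /allpairsP[[i j] /= [_ _ ->]].
- move=> z; rewrite !ler_norml => /andP[x1 x2] /andP[y1 y2].
  have [|i i1 iz] := @grid_point R h (- A) (2 * A) (z ord0 ord0) h0.
    by rewrite x1/=; lra.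
  have [|j j1 jz] := @grid_point R h (- B) (2 * B) (z ord0 ord_max) h0.
    by rewrite y1/=; lra.
  eexists.
    apply/allpairsP; exists (i, j).
    by split; [rewrite mem_iota add0n leq0n i1|rewrite mem_iota add0n leq0n j1|reflexivity].
  by split.
- rewrite size_allpairs !size_iota natrM.
  have bd (a : R) : 0 <= a -> (Num.truncn (2 * a / h)).+1%:R <= 2 * Num.sqrt 2 * a / r + 1.
    move=> a0; apply: le_trans (truncnS_le _) _.
      by rewrite divr_ge0 ?mulr_ge0// ltW.
    rewrite lerD2r le_eqVlt; apply/orP; left; apply/eqP.
    by rewrite /h; field; rewrite !gt_eqF.
  by apply: ler_pM; rewrite ?bd.
Qed.

(** The three upper bounds on [kappa] correspond to the squares along the curve, to the area term of
    the rectangle, and to its boundary terms, where one or both side counts are replaced by 1. *)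
Lemma spiral_theta_cover (R : realType) (p' p q theta a kappa s : R) :
  0 < p' < 1 -> p' <= p -> p <= q -> 0 < theta -> theta <= 1 -> 0 <= a -> 0 < kappa ->
  kappa <= s - 1 - a * (1 - p') -> kappa <= a * (p' + q) + theta * (s - 2) ->
  kappa <= theta * (s - 1) ->
  exists2 C : R, 0 < C & forall delta, 0 < delta -> delta <= 1 ->
    has_theta_cover theta s (C * delta `^ kappa) delta (elliptical_spiral p q).
Proof.
move=> p'01 p'p pq th0 th1 a0 k0 k1 k2 k3; have /andP[p'0 p'1] := p'01.
have q0 : 0 < q by lra.
have [C1 C10 curve] := curve_squares p'01 p'p pq.
set k := 2 * Num.sqrt 2 : R.
have kk0 : 0 <= k by rewrite mulr_ge0// sqrtr_ge0.
exists (C1 + 1 + (k + 1) ^+ 2).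
  by rewrite ltr_pwDr// ?exprn_gt0 ?addr_ge0// ltr_wpDl.
move=> delta d0 d1.
(* [W] is the value of [t ^ (1 - p')] at the splitting time [delta ^ (- a)]; [A] and [B] bound the
   two coordinates after that time. *)
pose W := delta `^ (- (a * (1 - p'))); pose A := delta `^ (a * p').
pose B := delta `^ (a * q); pose r := delta `^ theta.
have ap0 : 0 <= a * (1 - p') by rewrite mulr_ge0//; lra.
have de x y : x <= y -> delta `^ y <= delta `^ x by apply: ger_powR; rewrite d0.
have W1 : 1 <= W by rewrite -(powRr0 delta) de// oppr_le0.
have A0 : 0 <= A by exact: powR_ge0.
have B0 : 0 <= B by exact: powR_ge0.
have r0 : 0 < r by exact: powR_gt0.
have dr : delta <= r by apply: ger1_powR => //; rewrite d0.
have [l1 [l1r l1c l1s]] := curve W delta W1 d0.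
have [l2 [l2r l2c l2s]] := rectangle_squares A0 B0 r0.
apply: (@has_theta_cover_squares _ _ _ _ _ _ (l1 ++ l2)); first exact: ltW.
- move=> c; rewrite mem_cat => /orP[/l1r ->|/l2r ->]; first by rewrite lexx.
  by rewrite dr lexx.
- move=> _ [t t1 <-]; rewrite -/(spiral_pt p q t).
  have t0 : 0 < t by apply: lt_trans t1.
  have [tM|Mt] := leP t (delta `^ (- a)).
    have [|c cl sc] := l1c (t `^ (1 - p')).
      rewrite powR_ge1 ?(ltW t1)//=; last by lra.
      rewrite /W -mulNr powRrM; apply: ge0_ler_powR => //; last 2 first.
      - by rewrite nnegrE ltW.
      - by rewrite nnegrE powR_ge0.
      by lra.
    exists c; first by rewrite mem_cat cl.
    by move: sc; rewrite -powRrM divff ?powRr1 ?(ltW t0)// lt0r_neq0//; lra.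
  have small x y : p' <= x -> `|y| <= 1 -> `|t `^ (- x) * y| <= delta `^ (a * x).
    move=> px y1; rewrite normrM ger0_norm ?powR_ge0//.
    apply: le_trans (_ : t `^ (- x) * 1 <= _); first by rewrite ler_wpM2l ?powR_ge0.
    have -> : a * x = (- a) * (- x) by ring.
    by rewrite mulr1 powRrM; apply: powRN_le; [lra|exact: powR_gt0|exact: ltW].
  have [||c cl sc] := l2c (spiral_pt p q t).
  + rewrite spiral_pt_x; apply: le_trans (small _ _ p'p (cos_max t)) _.
    by apply: de; rewrite ler_wpM2l.
  + by rewrite spiral_pt_y; apply: small (sin_max t); exact: le_trans pq.
  by exists c => //; rewrite mem_cat cl orbT.
rewrite big_cat/= (sum_powR_const_fst _ l1r) (sum_powR_const_fst _ l2r).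
have E0 : 0 <= delta `^ kappa by exact: powR_ge0.
have th : 0 <= theta by exact: ltW.
rewrite mulrDl; apply: lerD.
  apply: le_trans (_ : (C1 * W / delta + 1) * delta `^ s <= _).
    by rewrite ler_wpM2r ?powR_ge0.
  rewrite mulrDl mul1r mulrDl mul1r; apply: lerD; last by apply: de; lra.
  have -> : C1 * W / delta * delta `^ s = C1 * (delta `^ (s - 1 - a * (1 - p'))).
    rewrite (_ : s - 1 - _ = - (a * (1 - p')) + (- 1 + s)); last by ring.
    by rewrite !(powRD_gt0 _ _ d0) powR_inv1 ?(ltW d0)// /W !mulrA.
  by rewrite ler_wpM2l// de.
apply: le_trans (_ : (k * A / r + 1) * (k * B / r + 1) * r `^ s <= _).
  by rewrite ler_wpM2r ?powR_ge0.
have rV : r^-1 = delta `^ (- theta) by rewrite powRN.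
have rs : r `^ s = delta `^ (theta * s) by rewrite powRrM.
have b1 : A * B * (r^-1 * r^-1 * r `^ s) <= delta `^ kappa.
  by rewrite rV rs -!(powRD_gt0 _ _ d0) de//; lra.
have ap'0 : 0 <= a * p' by rewrite mulr_ge0// ltW.
have aq0 : 0 <= a * q by rewrite mulr_ge0// ltW.
have b2 : A * (r^-1 * r `^ s) <= delta `^ kappa.
  by rewrite rV rs -!(powRD_gt0 _ _ d0) de//; lra.
have b3 : B * (r^-1 * r `^ s) <= delta `^ kappa.
  by rewrite rV rs -!(powRD_gt0 _ _ d0) de//; lra.
have b4 : r `^ s <= delta `^ kappa by rewrite rs de//; lra.
have -> : (k * A / r + 1) * (k * B / r + 1) * r `^ s =
  k ^+ 2 * (A * B * (r^-1 * r^-1 * r `^ s)) + k * (A * (r^-1 * r `^ s)) +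
  k * (B * (r^-1 * r `^ s)) + r `^ s by ring.
rewrite (_ : (k + 1) ^+ 2 * _ = k ^+ 2 * delta `^ kappa + k * delta `^ kappa +
  k * delta `^ kappa + delta `^ kappa); last by ring.
by rewrite !lerD// ler_wpM2l// exprn_ge0.
Qed.

(** * The critical exponent and the dimensions *)

(** This [a] balances the two parts of the cover: at [s = 1 + a * (1 - p)] the first two bounds on
    [kappa] in [spiral_theta_cover], taken with [p' = p], are both 0. *)
Lemma critical_exponentE (R : realType) (p q theta a : R) :
  0 < p -> p <= 1 -> p <= q -> 0 <= theta -> a = theta / (p + q + theta * (1 - p)) ->
  [/\ 0 <= a, a * (1 - p) <= 1, a * (p + q) = theta * (1 - a * (1 - p)) &
    (p + q + 2 * theta * (1 - p)) / (p + q + theta * (1 - p)) = 1 + a * (1 - p)].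
Proof.
move=> p0 p1 pq th0 ->.
have tp : 0 <= theta * (1 - p) by rewrite mulr_ge0//; lra.
have den0 : 0 < p + q + theta * (1 - p) by lra.
have n0 := lt0r_neq0 den0.
split.
- by rewrite divr_ge0// ltW.
- by rewrite mulrAC ler_pdivrMr//; lra.
- by field.
- by field.
Qed.

Definition eventually_theta_cover (R : realType) (n : nat) (theta s : R)
    (E : set 'rV[R]_n) : Prop :=
  forall eps : R, 0 < eps -> exists2 delta0 : R, 0 < delta0 &
    forall delta : R, 0 < delta <= delta0 -> has_theta_cover theta s eps delta E.

Lemma spiral_eventually_theta_cover (R : realType) (p' p q theta s : R) :
  0 < p' < 1 -> p' <= p -> p <= q -> 0 < theta -> theta <= 1 ->
  1 + theta / (p' + q + theta * (1 - p')) * (1 - p') < s ->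
  eventually_theta_cover theta s (elliptical_spiral p q).
Proof.
move=> p'01 p'p pq th0 th1; have /andP[p'0 p'1] := p'01.
set a := theta / _ => ss.
have [a0 ap apq _] := critical_exponentE p'0 (ltW p'1) (le_trans p'p pq) (ltW th0) (erefl a).
move: a a0 ap apq ss => a a0 ap apq ss.
(* If [s] exceeds the critical value by [e], the three bounds are [e], exactly [theta * e], and at
   least [theta * e]. *)
pose kappa := theta * (s - (1 + a * (1 - p'))).
have k0 : 0 < kappa by rewrite mulr_gt0// subr_gt0.
have ap0 : 0 <= a * (1 - p') by rewrite mulr_ge0//; lra.
have [C C0 HC] : exists2 C : R, 0 < C & forall delta, 0 < delta -> delta <= 1 ->
    has_theta_cover theta s (C * delta `^ kappa) delta (elliptical_spiral p q).
  apply: (spiral_theta_cover (p' := p') (a := a)) => //.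
  - by apply: le_trans (_ : 1 * (s - (1 + a * (1 - p'))) <= _);
      [rewrite ler_wpM2r// subr_ge0 ltW|lra].
  - by rewrite apq /kappa; lra.
  - by rewrite ler_wpM2l// ?(ltW th0)//; lra.
(* The threshold solves [C * delta ^ kappa = eps]. *)
move=> eps e0; exists (Num.min 1 ((eps / C) `^ kappa^-1)).
  by rewrite lt_min ltr01 powR_gt0// divr_gt0.
move=> delta /andP[d0]; rewrite le_min => /andP[d1 de].
have [I [U [cov dU sU]]] := HC delta d0 d1.
exists I, U; split => //; apply: le_trans sU _; rewrite lee_fin.
rewrite mulrC -ler_pdivlMr//.
have ec0 : 0 <= eps / C by rewrite divr_ge0// ltW.
by apply: powR_le_root => //; exact: ltW.
Qed.

Lemma hausdorff_premeasure_ge0 (R : realType) (n : nat) (s delta : R)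
  (E : set 'rV[R]_n) : (0 <= hausdorff_premeasure s delta E)%E.
Proof.
by apply: le_ereal_inf_tmp => _ [I [U [_ _ ->]]]; apply: esum_ge0 => i _; exact: poweR_ge0.
Qed.

(** Once [delta ^ theta <= d], a cover for [theta] at scale [delta] is admissible in the premeasure
    at scale [d]. *)
Lemma hausdorff_measure_eq0 (R : realType) (n : nat) (theta s : R) (E : set 'rV[R]_n) :
  0 < theta -> eventually_theta_cover theta s E -> hausdorff_measure s E = 0%E.
Proof.
move=> th0 H; apply/eqP; rewrite eq_le; apply/andP; split; last first.
  apply: le_trans (hausdorff_premeasure_ge0 s 1 E) _.
  by apply: ereal_sup_ubound; exists 1 => //=; exact: ltr01.
apply: ge_ereal_sup => _ [d /= d0 <-].
apply/lee_addgt0Pr => eps e0; rewrite add0e.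
have [delta0 dd0 Hd] := H _ e0.
pose delta := Num.min delta0 (d `^ theta^-1).
have de0 : 0 < delta by rewrite lt_min dd0 powR_gt0.
have [|I [U [cov dU sU]]] := Hd delta; first by rewrite de0 ge_min lexx.
apply: le_trans sU; apply: ereal_inf_lbound; exists I, U; split => // i /dU /andP[_].
move=> /le_trans; apply; rewrite lee_fin.
apply: powR_le_root => //; [exact: ltW|exact: ltW|].
by rewrite ge_min lexx orbT.
Qed.

Lemma ereal_inf_threshold (R : realType) (V : R) (P : set R) :
  (forall s, V < s -> P s) -> (forall s, P s -> V <= s) ->
  ereal_inf [set s%:E | s in P] = V%:E.
Proof.
move=> VP PV; apply/eqP; rewrite eq_le; apply/andP; split.
  apply/lee_addgt0Pr => e e0; apply: ereal_inf_lbound.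
  by exists (V + e) => //; apply: VP; rewrite ltrDl.
by apply: le_ereal_inf_tmp => _ [s Ps <-]; rewrite lee_fin PV.
Qed.

(** As [c] does not depend on [delta], no [delta <= 1] at all admits a cover with sum [c / 2]. This
    bounds even the lower dimension, whose condition on [s] is the weaker one. *)
Lemma intermediate_dims_eq (R : realType) (n : nat) (theta V : R) (E : set 'rV[R]_n) :
  0 < theta -> 0 <= V ->
  (forall s, V < s -> eventually_theta_cover theta s E) ->
  (forall s, s < V -> exists2 c : R, 0 < c & forall delta I U, 0 < delta -> delta <= 1 ->
    is_cover E I U ->
    (forall i, I i -> (delta%:E <= diam (U i) <= (delta `^ theta)%:E)%E) ->
    (c%:E <= diam_sum s I U)%E) ->
  lower_intermediate_dim theta E = V%:E /\ upper_intermediate_dim theta E = V%:E.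
Proof.
move=> th0 V0 up low.
have freq s : eventually_theta_cover theta s E ->
    forall eps delta0 : R, 0 < eps -> 0 < delta0 -> exists delta : R,
      0 < delta <= delta0 /\ has_theta_cover theta s eps delta E.
  move=> H eps delta0 e0 d0; have [d1 d10 Hd] := H _ e0.
  exists (Num.min delta0 d1); have m0 : 0 < Num.min delta0 d1 by rewrite lt_min d0.
  by split; [rewrite m0 ge_min lexx|apply: Hd; rewrite m0 ge_min lexx orbT].
have lowV s : (forall eps delta0 : R, 0 < eps -> 0 < delta0 -> exists delta : R,
      0 < delta <= delta0 /\ has_theta_cover theta s eps delta E) -> V <= s.
  move=> H; rewrite leNgt; apply/negP => /low[c c0 Hc].
  have c20 : 0 < c / 2 by rewrite divr_gt0.
  have [delta [/andP[d0 d1] [I [U [cov dU sU]]]]] := H _ _ c20 (@ltr01 R).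
  by have := le_trans (Hc _ _ _ d0 d1 cov dU) sU; rewrite lee_fin; lra.
rewrite /lower_intermediate_dim /upper_intermediate_dim gt_eqF//.
split; apply: ereal_inf_threshold => s.
- by move=> Vs; split; [exact: le_trans V0 (ltW Vs)|exact/freq/up].
- by move=> [_ /lowV].
- by move=> Vs; split; [exact: le_trans V0 (ltW Vs)|exact: up].
- by move=> [_ /freq/lowV].
Qed.

(** With [p' = 1 - e] the critical value is at most [1 + e], because [theta / D <= 1]; and
    [e < s - 1]. *)
Lemma spiral_theta_cover_gt1 (R : realType) (p q theta s : R) :
  1 <= p -> p <= q -> 0 < theta -> theta <= 1 -> 1 < s ->
  eventually_theta_cover theta s (elliptical_spiral p q).
Proof.
move=> p1 pq th0 th1 s1; pose e := Num.min (1/2) ((s - 1) / 2).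
have e0 : 0 < e by rewrite lt_min; apply/andP; split; lra.
have [e1 e2] : e <= 1/2 /\ e <= (s - 1) / 2.
  by split; rewrite ge_min lexx ?orbT.
apply: (@spiral_eventually_theta_cover _ (1 - e)) => //; try lra.
set D := _ + theta * _.
have De : theta * (1 - (1 - e)) >= 0 by rewrite mulr_ge0//; lra.
have D0 : theta <= D by rewrite /D; lra.
have tD : theta / D <= 1 by rewrite ler_pdivrMr ?mul1r// (lt_le_trans th0).
have : theta / D * (1 - (1 - e)) <= 1 * (1 - (1 - e)) by rewrite ler_wpM2r//; lra.
lra.
Qed.

(** For [s > 1], covers for a small positive [theta] show that the measure is 0, since the critical
    value tends to 1 with [theta]. For [s < 1], one arc keeps the premeasure at scale 1 positive. *)
Lemma spiral_hausdorff_dim (R : realType) (p q : R) : 0 < p -> p <= q ->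
  hausdorff_dim (elliptical_spiral p q) = 1%:E.
Proof.
move=> p0 pq; apply: ereal_inf_threshold => s.
  move=> s1; split; first by lra.
  (* Since the denominator [D] is at least [q], this gives [th / D <= (s - 1) / 2]. *)
  pose th := Num.min 1 ((s - 1) * q / 2).
  have q0 : 0 < q by lra.
  have th0 : 0 < th by rewrite lt_min ltr01/= divr_gt0// mulr_gt0// subr_gt0.
  have [t1 t2] : th <= 1 /\ th <= (s - 1) * q / 2.
    by split; rewrite ge_min lexx ?orbT.
  apply: (hausdorff_measure_eq0 th0).
  pose p' := Num.min p (1/2).
  have p'0 : 0 < p' by rewrite lt_min p0/=; lra.
  have [pp1 pp2] : p' <= p /\ p' <= 1/2 by split; rewrite ge_min lexx ?orbT.
  apply: (@spiral_eventually_theta_cover _ p') => //; first by rewrite p'0/=; lra.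
  set D := _ + th * _.
  have De : th * (1 - p') >= 0 by rewrite mulr_ge0// ?(ltW th0)//; lra.
  have D0 : q <= D by rewrite /D; lra.
  have D00 : 0 < D by exact: lt_le_trans D0.
  have tD : th / D <= (s - 1) / 2.
    rewrite ler_pdivrMr//; apply: le_trans t2 _.
    by rewrite mulrAC ler_wpM2l//; lra.
  have tD0 : 0 <= th / D by rewrite divr_ge0// ltW.
  have : th / D * (1 - p') <= th / D * 1 by rewrite ler_wpM2l//; lra.
  rewrite mulr1; lra.
move=> [_ H]; rewrite leNgt; apply/negP => s1.
have [c c0 Hc] := spiral_diam_sum_ge_le1 p0 pq.
have : (c%:E <= hausdorff_measure s (elliptical_spiral p q))%E.
  apply: (@le_trans _ _ (hausdorff_premeasure s 1 (elliptical_spiral p q))).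
    apply: le_ereal_inf_tmp => _ [I [U [cov dU ->]]].
    by apply: Hc => //; exact: ltW.
  by apply: ereal_sup_ubound; exists 1 => //=; exact: ltr01.
by rewrite H lee_fin leNgt c0.
Qed.

Theorem theorem2p1 (R : realType) (theta p q : R)
    (htheta : 0 <= theta <= 1) (hp : 0 < p) (hpq : p <= q) :
  let S := elliptical_spiral p q in
  [/\ lower_intermediate_dim theta S = upper_intermediate_dim theta S,
      p < 1 -> lower_intermediate_dim theta S =
        ((p + q + 2 * theta * (1 - p)) / (p + q + theta * (1 - p)))%:E
    & 1 <= p -> lower_intermediate_dim theta S = 1%:E].
Proof.
move=> S; have /andP[th0 th1] := htheta.
(* At [theta = 0] both dimensions are the Hausdorff dimension, and the formula reduces to
   [(p + q) / (p + q) = 1]. *)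
have [theta0|thn0] := eqVneq theta 0.
  have dim1 : lower_intermediate_dim theta S = 1%:E.
    by rewrite /lower_intermediate_dim theta0 eqxx spiral_hausdorff_dim.
  split => // [|p1].
    by rewrite dim1 /upper_intermediate_dim theta0 eqxx spiral_hausdorff_dim.
  by rewrite dim1 theta0 mulr0 !mul0r addr0 divff// gt_eqF//; lra.
have {thn0} th : 0 < theta by rewrite lt_neqAle eq_sym thn0.
have [p1|p1] := ltP p 1.
  have [a0 ap apq ->] := critical_exponentE hp (ltW p1) hpq th0 (erefl _).
  have ap0 : 0 <= 1 - p by lra.
  have [|s Vs|s sV|-> ->] := @intermediate_dims_eq R 2 theta
     (1 + theta / (p + q + theta * (1 - p)) * (1 - p)) S th.
  - by rewrite addr_ge0// mulr_ge0.
  - by apply: spiral_eventually_theta_cover Vs; rewrite ?hp.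
  - have [c c0 H] := spiral_diam_sum_ge hp p1 hpq th0 a0 ap apq.
    by exists c => // delta I U; apply: H; exact: ltW.
  - by split => //; rewrite leNgt p1.
have [|s Vs|s sV|-> ->] := @intermediate_dims_eq R 2 theta 1 S th.
- exact: ler01.
- exact: spiral_theta_cover_gt1.
- have [c c0 H] := spiral_diam_sum_ge_le1 hp hpq.
  exists c => // delta I U d0 d1 cov dU; apply: H => //; first exact: ltW.
  move=> i /dU/andP[_ /le_trans]; apply; rewrite lee_fin -(powRr0 delta).
  by apply: ger_powR => //; rewrite d0.
- by split => //; rewrite ltNge p1.
Qed.
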